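(* Let the odd couplings $a$ be fixed and suppose that $K_{ff}$ is symmetric and invertible at every admissible stiffness vector $k$ (this holds in particular for a passive network, $a\equiv 0$ with $K_{ff}\succ0$). Then for every admissible stiffness vector $k$, $$\operatorname{rank}\frac{\partial R}{\partial k}\;\le\;\min\Bigl(n_b,\ m_Tm_S-\tfrac12p(p-1)\Bigr).$$ In particular, when $T=S$ and $m_T=m_S=m$, the set of response blocks reachable by varying $k$ has local dimension at most $m(m+1)/2$, so that a fraction at least $(m-1)/(2m)$ of the $m^2$ dimensions of $\mathbb{R}^{m\times m}$ is unreachable, for every such network, whatever its size and topology.
   Context: Network: $N$ point nodes at positions $x_i\in\mathbb{R}^2$ are joined by $n_b$ bonds. For a bond $b=(i,j)$ of length $L_b=|x_j-x_i|>0$ let $\hat n_b=(x_j-x_i)/L_b$ and let $\hat t_b$ be $\hat n_b$ rotated by $+90^\circ$. The vector $q_b\in\mathbb{R}^{2N}$ carries $-\hat n_b$ at node $i$, $+\hat n_b$ at node $j$ and zeros elsewhere; $s_b$ is defined identically with $\hat t_b$ in place of $\hat n_b$. For stiffnesses $k=(k_b)$ and odd couplings $a=(a_b)\in\mathbb{R}^{n_b}$ put $K=\sum_b(k_bq_b+a_bs_b)q_b^{T}$. Three degrees of freedom (coordinates) are pinned to remove the planar rigid-body modes; $K_{ff}$ is the restriction (principal submatrix) of $K$ to the remaining $n_{\mathrm{free}}=2N-3$ free degrees of freedom, and $C=K_{ff}^{-1}$. A stiffness vector $k$ is admissible if $k_b>0$ for every $b$ and $K_{ff}$ is invertible. Response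 block: $S$ (driven) and $T$ (read) are sets of free degrees of freedom, $|S|=m_S$, $|T|=m_T$, $p=|T\cap S|$, and $R=R(k)=C[T,S]\in\mathbb{R}^{m_T\times m_S}$. $\partial R/\partial k$ is the $m_Tm_S\times n_b$ Jacobian of the flattened block. The local dimension of the reachable set $\{R(k)\}$ at a generic $k$ (where the rank is locally constant) means the rank of $\partial R/\partial k$ there. *)

(* Defs.v *)
From mathcomp Require Import all_boot all_order all_algebra.
From mathcomp Require Import all_classical all_reals all_analysis.

Set Implicit Arguments.
Unset Strict Implicit.
Unset Printing Implicit Defensive.

Import Order.TTheory GRing.Theory Num.Theory.
Import numFieldNormedType.Exports.

Local Open Scope ring_scope.

(* The library norm on ['rV[R]_2] is the sup norm, hence this definition. *)
Definition eucl_len (R : realType) (v : 'rV[R]_2) : R :=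
  Num.sqrt (\sum_c v 0 c ^+ 2).

Definition rot90 (R : realType) (v : 'rV[R]_2) : 'rV[R]_2 :=
  \row_c (if c == 0 then - v 0 1 else v 0 0).

(* A planar field [u : 'M_(N, 2)] has one row per node; its flattening [mxvec u]
   indexes the 2N degrees of freedom by ['I_(N * 2)], coordinate [c] of node
   [v] being [mxvec_index v c]. *)

(* Infinitesimal rigid motions: a translation plus a rotation. *)
Definition rigid_motion (R : realType) (N : nat) (x : 'I_N -> 'rV[R]_2)
    (u : 'M[R]_(N, 2)) : Prop :=
  exists (t : 'rV[R]_2) (w : R), forall v, row v u = t + w *: rot90 (x v).

(* Bond [b] is the ordered pair [(src b, tgt b)]. *)
Record network (R : realType) (N nb : nat) := Network {
  pos : 'I_N -> 'rV[R]_2;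
  src : 'I_nb -> 'I_N;
  tgt : 'I_nb -> 'I_N;
  pinned : {set 'I_(N * 2)};
  bond_len_gt0 : forall b, 0 < eucl_len (pos (tgt b) - pos (src b));
  card_pinned : #|pinned| = 3%N;
  pinned_no_rigid : forall u : 'M[R]_(N, 2), rigid_motion pos u ->
    (forall i, i \in pinned -> mxvec u 0 i = 0) -> u = 0
}.

Section Network.
Variables (R : realType) (N nb : nat) (G : network R N nb).

Definition bond_len (b : 'I_nb) : R :=
  eucl_len (pos G (tgt G b) - pos G (src G b)).

Definition bond_dir (b : 'I_nb) : 'rV[R]_2 :=
  (bond_len b)^-1 *: (pos G (tgt G b) - pos G (src G b)).

Definition bond_perp (b : 'I_nb) : 'rV[R]_2 := rot90 (bond_dir b).

Definition bond_vec (b : 'I_nb) (d : 'rV[R]_2) : 'cV[R]_(N * 2) :=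
  (mxvec (\matrix_(v < N, c < 2)
     if v == src G b then - d 0 c else if v == tgt G b then d 0 c else 0))^T.

Definition qvec (b : 'I_nb) : 'cV[R]_(N * 2) := bond_vec b (bond_dir b).
Definition svec (b : 'I_nb) : 'cV[R]_(N * 2) := bond_vec b (bond_perp b).

Definition stiffness (a k : 'rV[R]_nb) : 'M[R]_(N * 2) :=
  \sum_b (k 0 b *: qvec b + a 0 b *: svec b) *m (qvec b)^T.

(* The free degrees of freedom are re-indexed by ['I_nfree]; the original index
   of [i : 'I_nfree] is [enum_val i]. *)
Definition nfree : nat := #|~: pinned G|.

Lemma nfreeE : nfree = (2 * N - 3)%N.
Proof. by rewrite /nfree cardsCs finset.setCK card_pinned card_ord mulnC. Qed.

Definition Kff (a k : 'rV[R]_nb) : 'M[R]_nfree :=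
  mxsub (@enum_val _ (mem (~: pinned G))) (@enum_val _ (mem (~: pinned G)))
    (stiffness a k).

Definition Cff (a k : 'rV[R]_nb) : 'M[R]_nfree := invmx (Kff a k).

Definition admissible (a k : 'rV[R]_nb) : Prop :=
  (forall b, 0 < k 0 b) /\ Kff a k \in unitmx.

Definition response (a : 'rV[R]_nb) (T S : {set 'I_nfree}) (k : 'rV[R]_nb) :
    'M[R]_(#|T|, #|S|) :=
  mxsub (@enum_val _ (mem T)) (@enum_val _ (mem S)) (Cff a k).

(* The library's [jacobian] acts on row vectors, so it is the transpose of the
   usual one (rows indexed by outputs, columns by inputs). *)
Definition dresponse (a : 'rV[R]_nb) (T S : {set 'I_nfree}) (k : 'rV[R]_nb) :
    'M[R]_(#|T| * #|S|, nb) :=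
  (jacobian (fun k' : 'rV[R]_nb => mxvec (response a T S k')) k)^T.

(* [d] is the local dimension of the set of reachable response blocks at the
   generic stiffness vector [k]. *)
Definition reachable_local_dim (a : 'rV[R]_nb) (T S : {set 'I_nfree})
    (k : 'rV[R]_nb) (d : nat) : Prop :=
  (\forall k' \near k, \rank (dresponse a T S k') = \rank (dresponse a T S k))
  /\ \rank (dresponse a T S k) = d.

End Network.

(* Symmetry is deliberately not built in. *)
Definition posdef (R : realType) (n : nat) (A : 'M[R]_n) : Prop :=
  forall u : 'cV[R]_n, u != 0 -> 0 < (u^T *m A *m u) 0 0.

(* Main.v *)
(* Admissibility is an open condition on [k], so the symmetry of [Kff], hence of
   its inverse, holds on a whole neighbourhood of an admissible [k]. For [i], [j]
   in [T :&: S] the response entries [(i, j)] and [(j, i)] therefore agree near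
   [k] and have the same gradient: [p(p-1)/2] rows of the Jacobian repeat other
   rows. *)
Require Import Defs.
From mathcomp Require Import all_boot all_order all_algebra.
From mathcomp Require Import all_classical all_reals all_analysis.
From mathcomp Require Import zify ring lra.
Import Order.TTheory GRing.Theory Num.Theory.
Import numFieldNormedType.Exports.
Local Open Scope ring_scope.

(** The square of [P] is the disjoint union of its strictly increasing pairs, their mirror images
    and the diagonal. *)
Lemma card_ltn_pairs n (P : {set 'I_n}) :
  (2 * #|[set ij : 'I_n * 'I_n | [&& ij.1 \in P, ij.2 \in P & (ij.1 < ij.2)%N]]|
   = #|P| * (#|P| - 1))%N.
Proof.
set B := finset _.
pose swap (ij : 'I_n * 'I_n) := (ij.2, ij.1).
have swapK : cancel swap swap by case.
pose D := [set (i, i) | i in P]%SET.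
have -> : (2 * #|B| = #|B| + #|(swap @: B)%SET|)%N.
  by rewrite (card_imset _ (can_inj swapK)) mul2n addnn.
have cD : #|D| = #|P| by rewrite card_imset // => i j [].
have memB i j : ((i, j) \in B) = [&& i \in P, j \in P & (i < j)%N] by rewrite inE.
have memB' i j : ((i, j) \in (swap @: B)%SET) = [&& i \in P, j \in P & (j < i)%N].
  apply/imsetP/idP => [[[u v]]|/and3P[iP jP ji]].
    by rewrite memB => /and3P[uP vP uv] [-> ->]; rewrite uP vP.
  by exists (j, i); rewrite // memB iP jP.
have memD i j : ((i, j) \in D) = [&& i \in P, j \in P & i == j].
  apply/imsetP/idP => [[u uP [-> ->]]|/and3P[iP _ /eqP <-]]; last by exists i.
  by rewrite uP eqxx.
have XE : finset.setX P P = (B :|: (swap @: B) :|: D)%SET.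
  apply/setP => -[i j]; rewrite !finset.in_setU memB memB' memD finset.in_setX /=.
  rewrite -(inj_eq val_inj) /=.
  by case: (i \in P) => //=; case: (j \in P) => //=; case: ltngtP.
have := cardsX P P.
have dis0 : (B :&: (swap @: B) = finset.set0)%SET.
  apply/setP => -[i j]; rewrite finset.in_setI memB memB' finset.in_set0.
  by apply/negP => /andP[/and3P[_ _ u] /and3P[_ _ v]]; lia.
have dis1 : ((B :|: (swap @: B)) :&: D = finset.set0)%SET.
  apply/setP => -[i j]; rewrite finset.in_setI finset.in_setU memB memB' memD.
  rewrite finset.in_set0 -(inj_eq val_inj) /=.
  by apply/negP => /andP[/orP[] /and3P[_ _ u] /and3P[_ _ /eqP v]]; lia.
rewrite XE cardsU dis1 cardsU dis0 cards0 cD !subn0 mulnBr muln1 => <-.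
by rewrite addnK.
Qed.

(** The rows outside [B] already span the row space, and there are [m - #|B|] of them. *)
Lemma mxrank_repeated_rows (F : fieldType) (m n : nat) (A : 'M[F]_(m, n))
    (B : {set 'I_m}) :
  (forall i, i \in B -> exists2 j, j \notin B & row i A = row j A) ->
  (\rank A <= m - #|B|)%N.
Proof.
move=> hB.
pose f (k : 'I_#|~: B|%SET) : 'I_m := enum_val k.
suff /mxrankS Af : (A <= rowsub f A)%MS.
  apply: leq_trans Af _; apply: leq_trans (rank_leq_row _) _.
  by rewrite cardsCs finset.setCK card_ord.
apply/row_subP => i.
wlog iB : i / i \notin B => [wl|].
  case: (boolP (i \in B)) => [/hB[j jB ->]|]; exact: wl.
have iC : i \in (~: B)%SET by rewrite finset.in_setC.
apply: (@eq_row_sub _ _ _ _ _ (enum_rank_in iC i)).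
by apply/rowP => j; rewrite !mxE /f enum_rankK_in.
Qed.

(* No differentiability hypothesis: where [f] is not differentiable, ['d f x] is
   the junk value [point], the zero map. *)
Lemma jacobian_eq_coord (R : realType) (m n : nat) (f : 'rV[R]_m -> 'rV[R]_n)
    (x : 'rV[R]_m) (i j : 'I_n) :
  (\forall y \near x, f y 0 i = f y 0 j) ->
  forall b, jacobian f x b i = jacobian f x b j.
Proof.
move=> fij b; rewrite /jacobian !mxE.
have [fx|nfx] := pselect (differentiable f x).
  rewrite -!deriveE // derive_mx; last exact: diff_derivable.
  by rewrite !mxE; apply: near_eq_derive.
suff -> : 'd f x = point by rewrite !mxE.
(* ['d f x] is chosen among the maps with the defining property of a differential; one such map
   would already make [f] differentiable at [x]. *)
rewrite /diff; apply: getPN => df [dfc dfE]; apply: nfx.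
apply/diffP; rewrite /diff.
by have := @getI _ (fun df : {linear 'rV[R]_m -> 'rV[R]_n} => _) df
             (conj dfc dfE).
Qed.

Lemma continuous_det (R : realType) (T : topologicalType) (n : nat)
    (A : T -> 'M[R]_n) :
  (forall i j, continuous (fun x => A x i j)) -> continuous (fun x => \det (A x)).
Proof.
move=> cA; rewrite /determinant.
apply: continuous_big => [|s _ x]; first exact: add_continuous.
apply: cvgM; first exact: cvg_cst.
move: x; apply: continuous_big => [|i _]; first exact: mul_continuous.
exact: cA.
Qed.

(** The quadratic form vanishes at any kernel vector of [A]. Passing to the transpose turns the left
    kernel [kermx] into the right one. *)
Lemma posdef_unitmx (R : realType) (n : nat) (A : 'M[R]_n) :
  posdef A -> A \in unitmx.
Proof.
move=> pA; rewrite -unitmx_tr -row_free_unit -kermx_eq0; apply/rowV0P => u.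
move=> /sub_kermxP uA; apply/eqP; apply: contraT => u0.
have /pA : u^T != 0 by rewrite trmx_eq0.
by rewrite -mulmxA -[A]trmxK -trmx_mul uA trmx0 mulmx0 mxE ltxx.
Qed.

Section Network.
Variables (R : realType) (N nb : nat) (G : network R N nb).
Implicit Types (a k : 'rV[R]_nb).

(** Without odd couplings each bond contributes a multiple of the symmetric rank-one matrix
    [q q^T]. *)
Lemma stiffness_sym k : (stiffness G 0 k)^T = stiffness G 0 k.
Proof.
rewrite /stiffness linear_sum; apply: eq_bigr => b _ /=.
by rewrite mxE scale0r addr0 -scalemxAl linearZ /= trmx_mul trmxK.
Qed.

Lemma Kff_sym k : (Kff G 0 k)^T = Kff G 0 k.
Proof. by rewrite /Kff trmx_mxsub stiffness_sym. Qed.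

(** The entries of [Kff] are affine in [k], so its determinant is continuous and stays nonzero
    nearby; positivity amounts to finitely many open conditions. *)
Lemma admissible_near a k :
  admissible G a k -> \forall k' \near k, admissible G a k'.
Proof.
move=> [k0 kU]; have ck b : continuous (fun k' : 'rV[R]_nb => k' 0 b).
  by move=> x; exact: coord_continuous.
have cdet : continuous (fun k' => \det (Kff G a k')).
  apply: continuous_det => i j.
  have -> : (fun k' => Kff G a k' i j) = fun k' => \sum_b
      (k' 0 b * qvec G b (enum_val i) 0 + a 0 b * svec G b (enum_val i) 0)
      * qvec G b (enum_val j) 0.
    apply/funext => k'; rewrite mxE summxE; apply: eq_bigr => b _.
    by rewrite mxE big_ord1 !mxE.
  apply: continuous_big => [|b _ x]; first exact: add_continuous.
  apply: (cvgM (cvgD (cvgM (ck b x) (cvg_cst _)) (cvg_cst _)) (cvg_cst _)).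
have dk : \forall k' \near k, \det (Kff G a k') != 0.
  by apply: (cvgr_neq0 _ (cdet k)); rewrite -unitfE -unitmxE.
have pk : \forall k' \near k, forall b : 'I_nb, 0 < (k' : 'rV[R]_nb) 0 b.
  apply: (@filter_forall _ _ (fun b k' => 0 < (k' : 'rV[R]_nb) 0 b) (nbhs k)) => b.
  by apply: (cvgr_gt _ (ck b k)); exact: k0.
by apply: filterS2 pk dk => k' k'0 dk'; split; rewrite // unitmxE unitfE.
Qed.

Lemma response_rank a (T S : {set 'I_(nfree G)}) k :
  (forall k', admissible G a k' -> (Kff G a k')^T = Kff G a k') ->
  admissible G a k ->
  (\rank (dresponse a T S k) <=
     #|T| * #|S| - (#|T :&: S| * (#|T :&: S| - 1)) %/ 2)%N.
Proof.
move=> Ksym kadm.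
pose I := ('I_#|T| * 'I_#|S|)%type.
(* [T] and [S] are enumerated separately, so positions in the block can be mirrored only through the
   degrees of freedom that they stand for. *)
pose dof (ij : I) := (enum_val ij.1, enum_val ij.2).
have dof_inj : injective dof.
  by move=> [i j] [i' j'] [/enum_val_inj -> /enum_val_inj ->].
pose idx (ij : I) := mxvec_index ij.1 ij.2.
have idx_inj : injective idx.
  case: (curry_mxvec_bij #|T| #|S|) => g gK _ u v uv.
  by rewrite -(gK u) ?inE // -(gK v) ?inE //; congr g; case: u v uv => ? ? [].
pose B0 := [set ij | [&& ij.1 \in T :&: S, ij.2 \in T :&: S & (ij.1 < ij.2)%N]]%SET.
pose B1 := [set ij : I | dof ij \in B0]%SET.
have surj i j : i \in T -> j \in S -> exists ij, dof ij = (i, j).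
  move=> iT jS; exists (enum_rank_in iT i, enum_rank_in jS j).
  by rewrite /dof /= !enum_rankK_in.
(* Every pair in [B0] is the image under [dof] of some position in the block. *)
have leB : (#|B0| <= #|B1|)%N.
  rewrite -(card_imset _ dof_inj); apply/subset_leq_card/fintype.subsetP => -[i j].
  move=> ijB; have := ijB; rewrite !inE /= => /and3P[/andP[iT _] /andP[_ jS] _].
  have [ij ijE] := surj _ _ iT jS.
  by apply/imsetP; exists ij; rewrite /B1 ?ijE // finset.in_set ijE.
apply: (@leq_trans (#|T| * #|S| - #|(idx @: B1)%SET|)); last first.
  rewrite (card_imset _ idx_inj) -card_ltn_pairs mulKn //.
  exact: leq_sub2l.
apply: mxrank_repeated_rows => _ /imsetP[[i j]] ijB ->.
have := ijB; rewrite !inE /= => /and3P[/andP[iT iS] /andP[jT jS] ij].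
(* The mirror position has the two degrees of freedom exchanged; it exists as both lie in [T :&: S],
   and the reversed order keeps it out of [B1]. *)
have [[j' i'] [j'E i'E]] := surj _ _ jT iS.
exists (idx (j', i')).
  apply/imsetP => -[] uv uvB /idx_inj uvE; move: uvB; rewrite -uvE !inE /=.
  by rewrite j'E i'E => /and3P[_ _]; lia.
apply/rowP => b; rewrite [LHS]mxE [RHS]mxE /dresponse [LHS]mxE [RHS]mxE.
apply: jacobian_eq_coord.
apply: filterS (admissible_near _ _ kadm) => k' /Ksym Kk'.
have Csym : (Cff G a k')^T = Cff G a k' by rewrite /Cff trmx_inv Kk'.
by rewrite /idx !mxvecE [LHS]mxE [RHS]mxE j'E i'E -[in LHS]Csym mxE.
Qed.

End Network.

Theorem theorem1 (R : realType) (N nb : nat) (G : network R N nb)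
    (a : 'rV[R]_nb) :
  (a = 0 -> forall k : 'rV[R]_nb, (forall b, 0 < k 0 b) -> posdef (Kff G a k) ->
     (Kff G a k)^T = Kff G a k /\ Kff G a k \in unitmx)
  /\
  ((forall k : 'rV[R]_nb, admissible G a k ->
      (Kff G a k)^T = Kff G a k /\ Kff G a k \in unitmx) ->
   (forall (T S : {set 'I_(nfree G)}) (mT mS p : nat),
      #|T| = mT -> #|S| = mS -> #|T :&: S| = p ->
      forall k : 'rV[R]_nb, admissible G a k ->
      (\rank (dresponse a T S k) <= minn nb (mT * mS - (p * (p - 1)) %/ 2))%N)
   /\
   (forall (S : {set 'I_(nfree G)}) (m : nat), #|S| = m ->
      forall (k : 'rV[R]_nb) (d : nat), admissible G a k ->
      reachable_local_dim a S S k d ->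
      (d <= (m * (m + 1)) %/ 2)%N
      /\ ((0 < m)%N ->
          (m%:R - 1) / (2 * m%:R) <= ((m ^ 2)%N%:R - d%:R) / (m ^ 2)%N%:R :> R))).
Proof.
split=> [-> k _ pK|Ksym]; first by split; [exact: Kff_sym|exact: posdef_unitmx].
have rk (T S : {set 'I_(nfree G)}) k := response_rank _ _ _ G a T S k (fun k' h => (Ksym k' h).1).
split=> [T S _ _ _ <- <- <- k kadm|S m Sm k d kadm [_ rkd]].
  by rewrite leq_min rank_leq_col rk.
have dm : (d <= (m * (m + 1)) %/ 2)%N.
  rewrite -rkd; apply: leq_trans (rk _ _ _ kadm) _.
  rewrite finset.setIid Sm.
  (* Evenness makes the truncated halving exact, so that m^2 - m(m-1)/2 = m(m+1)/2 in [nat]. *)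
  have : (2 %| m * (m - 1))%N by case: (m) => // n; rewrite dvdn2 oddM subn1 /=; case: odd.
  nia.
split=> // m0.
have m0R : 0 < m%:R :> R by rewrite ltr0n.
have dmR : 2 * d%:R <= m%:R * (m%:R + 1) :> R.
  by rewrite natr1 -!natrM ler_nat; lia.
(* After multiplication by m^2 the claim reads m(m-1)/2 <= m^2 - d, which is [dmR] rearranged. *)
rewrite natrX ler_pdivlMr ?exprn_gt0 //.
have -> : (m%:R - 1) / (2 * m%:R) * m%:R ^+ 2 = (m%:R - 1) * m%:R / 2 :> R.
  by field; rewrite gt_eqF.
lra.
Qed.
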